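(* Let $N\ge 1$, let $K\in\mathbb{R}^{N\times N}$ be a symmetric matrix, let $G_K$ be the graph induced by $K$, and let $\ell\ge 3$ be an integer. The matrix $K$ is completely determined up to $\mathcal{D}_N$-similarity by its principal minors of size at most $\ell$ if and only if the cycle sparsity of $G_K$ is at most $\ell$. Here ''$K$ is completely determined up to $\mathcal{D}_N$-similarity by its principal minors of size at most $\ell$'' means: every symmetric matrix $K'\in\mathbb{R}^{N\times N}$ with $\det(K'_S)=\det(K_S)$ for all $S\subseteq[N]$ with $1\le |S|\le \ell$ satisfies $K'=DKD$ for some $D\in\mathcal{D}_N$.
   Context: $[N]=\{1,\dots,N\}$. For $S\subseteq[N]$, $K_S$ is the principal submatrix of $K$ with rows and columns indexed by $S$; $\det(K_S)$ is a principal minor of size $|S|$. $\mathcal{D}_N$ is the set of $N\times N$ diagonal matrices whose diagonal entries all lie in $\{-1,1\}$. The graph induced by $K$ is $G_K=([N],E)$, where for $i\neq j$, $\{i,j\}\in E$ if and only if $K_{i,j}\ne 0$. Cycle space: for a graph $G=([N],E)$ with $|E|=m$, a cycle of $G$ is a connected subgraph in which every vertex has even degree; its incidence vector $x\in GF(2)^m$ has $x_e=1$ if $e$ is an edge of the cycle and $x_e=0$ otherwise. The cycle space of $G$ is the subspace of $GF(2)^m$ spanned by the incidence vectors of the cycles of $G$. A simple cycle is a cycle whose vertices of nonzero degree all have degree two and form a connected set; its length is its number of edges; it is induced if it is an induced subgraph of $G$ (on its vertices of degree two). A cycle basis is a basis of the cycle space consisting of (incidence vectors of) simple cycles; every cycle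 space has a cycle basis made of induced cycles. The cycle sparsity of $G$ is the minimal $\ell$ for which $G$ admits a cycle basis of induced cycles of length at most $\ell$, with the convention that it equals $2$ when the cycle space is empty (i.e. trivial). *)

(* Defs.v *)
From HB Require Import structures.
From mathcomp Require Import all_boot all_order all_algebra.
From mathcomp Require Import boolp reals.

Set Implicit Arguments.
Unset Strict Implicit.
Unset Printing Implicit Defensive.

Import GRing.Theory.
Local Open Scope ring_scope.

Section Matrices.
Variables (R : realType) (N : nat).
Implicit Types (K D : 'M[R]_N) (S : {set 'I_N}).

Definition principal_submx K S : 'M[R]_#|S| :=
  mxsub (@enum_val _ (mem S)) (@enum_val _ (mem S)) K.

Definition sign_diag_mx D : Prop :=
  is_diag_mx D /\ forall i, D i i = 1 \/ D i i = - 1.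

Definition determined_by_minors K (l : nat) : Prop :=
  forall K' : 'M[R]_N, K'^T = K' ->
    (forall S, (1 <= #|S| <= l)%N ->
       \det (principal_submx K' S) = \det (principal_submx K S)) ->
    exists D, sign_diag_mx D /\ K' = D *m K *m D.

End Matrices.

(* Simple graph on all of V; edges are two-element sets of vertices. *)
Record sgraph (V : finType) := SGraph {
  edges : {set {set V}};
  edges_card2 : forall e, e \in edges -> #|e| = 2%N }.

Section InducedGraph.
Variables (R : realType) (N : nat) (K : 'M[R]_N).

Definition mx_edges : {set {set 'I_N}} :=
  [set [set p.1; p.2] | p : 'I_N * 'I_N & (p.1 != p.2) && (K p.1 p.2 != 0)].

Lemma mx_edges_card2 e : e \in mx_edges -> #|e| = 2%N.
Proof. by move=> /imsetP[p]; rewrite inE => /andP[ij _] ->; rewrite cards2 ij. Qed.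

Definition graph_of_mx : sgraph 'I_N := SGraph mx_edges_card2.

Lemma graph_of_mxE (i j : 'I_N) : K^T = K -> i != j ->
  ([set i; j] \in edges graph_of_mx) = (K i j != 0).
Proof.
move=> symK ij; apply/imsetP/idP => [[[a b]]|Kij]; last first.
  by exists (i, j); rewrite // inE ij.
rewrite inE /= => /andP[ab Kab] eqs.
have : i \in [set a; b] by rewrite -eqs set21.
have : j \in [set a; b] by rewrite -eqs set22.
rewrite !inE => /orP[]/eqP ej /orP[]/eqP ei; move: ij; rewrite ei ej ?eqxx //.
by move=> _; rewrite -symK mxE.
Qed.

End InducedGraph.

Section CycleSpace.
Variables (V : finType) (G : sgraph V).

(* A vertex set together with an edge set; see is_subgraph. *)
Local Notation subgraph := ({set V} * {set {set V}})%type.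
Implicit Types (H : subgraph) (W : {set V}) (C : {set {set V}}).

Definition is_subgraph H : bool :=
  (H.2 \subset edges G) && [forall e in H.2, e \subset H.1].

Definition degree C (v : V) : nat := #|[set e in C | v \in e]|.

(* The empty vertex set is not connected. *)
Definition connected_by W C : bool :=
  (W != set0) &&
  [forall x in W, forall y in W, connect [rel u v | [set u; v] \in C] x y].

Definition is_cycle H : bool :=
  [&& is_subgraph H, connected_by H.1 H.2 &
      [forall v in H.1, ~~ odd (degree H.2 v)]].

Definition edge : finType := {e : {set V} | e \in edges G}.

Definition incidence H : {ffun edge -> ('F_2)^o} :=
  [ffun e => (val e \in H.2)%:R].

Definition cycle_space : {vspace {ffun edge -> ('F_2)^o}} :=
  <<[seq incidence H | H in is_cycle]>>%VS.

(* Nonemptiness in connected_by excludes the edgeless one-vertex cycle. *)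
Definition simple_cycle H : bool :=
  let W' := [set v in H.1 | degree H.2 v != 0%N] in
  [&& is_cycle H, [forall v in W', degree H.2 v == 2%N] & connected_by W' H.2].

Definition cycle_length H : nat := #|H.2|.

Definition induced_cycle H : bool :=
  simple_cycle H &&
  [forall e in edges G,
     (e \subset [set v in H.1 | degree H.2 v == 2%N]) ==> (e \in H.2)].

Definition cycle_basis (s : seq subgraph) : bool :=
  all simple_cycle s && basis_of cycle_space [seq incidence H | H <- s].

Definition has_short_induced_basis (l : nat) : Prop :=
  exists s : seq subgraph,
    [/\ cycle_basis s, all induced_cycle s & all (fun H => (cycle_length H <= l)%N) s].

(* Every cycle space has a basis of induced cycles, so the value 0 is never
   taken. *)
Definition cycle_sparsity : nat :=
  if cycle_space == 0%VS then 2%N else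
  if pselect (exists l, `[< has_short_induced_basis l >]) is left exl
  then ex_minn exl else 0%N.

End CycleSpace.

(* Main.v *)
From HB Require Import structures.
Require Import Defs.
From mathcomp Require Import all_fingroup all_boot all_order all_algebra.
From mathcomp Require Import boolp reals zify.

(** Write [w e] in GF(2) for the sign by which a symmetric matrix with the same
diagonal and the same squared entries as [K] differs from [K] on the edge [e]
of the graph of [K]. The new matrix is [D K D] for a diagonal sign matrix [D]
exactly when [w] is a coboundary, [w {u, v} = d u + d v] on every edge; such a
[d] is called a potential of [w]. So the theorem compares two sets of weights
[w]: those that keep all minors of size at most [l], and those that have a
potential.

The graph side. A weight whose sums around all closed walks are zero has a
potential (sum along a path from a root of the component), and the sum around
a closed walk is zero as soon as the sums around holes, that is chordless simple
cycles, are: a closed walk with a repeated vertex or with a chord splits into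
two shorter ones, and the chord is counted twice ([cycle_sum0]). Applied to the
subgraph on a vertex set [S], this gives [hole_potential_in]: a weight that
sums to zero around the holes inside [S] has a potential on [S]. Conversely a
potential makes the sum over any even-degree edge set vanish, since each [d v]
is counted [degree v] times ([sum_potential_even]). By duality in the
finite-dimensional edge space ([separating_weight]), the induced cycles of
length at most [l] therefore span the cycle space if and only if every weight
that vanishes on them has a potential; [cycle_sparsity_leP] turns this into a
characterisation of the inequality on the cycle sparsity.

The matrix side. If a weight vanishes on the induced cycles of length at most
[l] and [#|S| <= l], it has a potential on [S], so that flipping signs along it
conjugates the submatrix on [S] by a sign matrix and keeps its determinant
([switch_minor]). Determination by minors then gives a global potential. For
the converse, minors of sizes one and two fix the diagonal and the squared
entries, so the other matrix comes from a weight [w]. The submatrix on a hole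
is supported on the diagonal and on one cyclic permutation [r] and its
inverse; in the Leibniz formula the permutations other than [r] and [r^-1] that
contribute are involutions and only see diagonal and squared entries. Hence the
minor determines the product of the entries around the hole
([det_cyclic_support], [hole_minor]), and [w] sums to zero around every hole of
size at most [l]. The vertices of an induced cycle of length at most [l] number
at most [l], so [w] has a potential on them and vanishes on the cycle; as the
sparsity is at most [l], [w] has a global potential. *)

Set Implicit Arguments.
Unset Strict Implicit.
Unset Printing Implicit Defensive.

Import Order.TTheory GRing.Theory Num.Theory.
Local Open Scope ring_scope.

(** * Weights on walks and potentials *)

Lemma F2_addrr (x : 'F_2) : x + x = 0.
Proof. exact/addrr_pchar2/pchar_Fp. Qed.

Section Walks.
Variables (V : finType) (e : rel V) (g : V -> V -> 'F_2).
Hypotheses (e_sym : symmetric e) (e_irr : irreflexive e).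
Hypothesis g_sym : forall x y, g x y = g y x.

(** Chordless cycles of the graph, encoded by the cyclic sequence of their vertices:
this is the form in which a closed walk can be cut and glued. *)
Definition hole (c : seq V) : bool :=
  [&& (2 < size c)%N, uniq c, cycle e c &
      [forall x in c, forall y in c,
         e x y ==> (y == next c x) || (x == next c y)]].

Fixpoint walk_sum (x : V) (p : seq V) : 'F_2 :=
  if p is y :: p' then g x y + walk_sum y p' else 0.

Definition cycle_sum (c : seq V) : 'F_2 :=
  if c is x :: q then walk_sum x (rcons q x) else 0.

Lemma walk_sum_cat x p1 p2 :
  walk_sum x (p1 ++ p2) = walk_sum x p1 + walk_sum (last x p1) p2.
Proof. by elim: p1 x => [|y p1 IHp] x /=; rewrite ?add0r // IHp addrA. Qed.

Lemma walk_sum_rcons x p y :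
  walk_sum x (rcons p y) = walk_sum x p + g (last x p) y.
Proof. by rewrite -cats1 walk_sum_cat /= addr0. Qed.

Lemma walk_sum_rev x p : walk_sum (last x p) (rev (belast x p)) = walk_sum x p.
Proof.
elim: p x => [|y p IHp] x //=.
rewrite rev_cons walk_sum_rcons IHp addrC g_sym.
by case: p {IHp} => //= z p; rewrite rev_cons last_rcons.
Qed.

Lemma cycle_sum_split y b z d :
  cycle_sum (y :: b ++ z :: d) = walk_sum y (rcons b z) + walk_sum z (rcons d y).
Proof.
by rewrite /cycle_sum rcons_cat rcons_cons -cat_rcons walk_sum_cat last_rcons.
Qed.

Lemma cycle_split y b z d :
  cycle e (y :: b ++ z :: d) = path e y (rcons b z) && path e z (rcons d y).
Proof. by rewrite /= rcons_cat rcons_cons -cat_rcons cat_path last_rcons. Qed.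

Lemma cycle_sum_catC a b : cycle_sum (a ++ b) = cycle_sum (b ++ a).
Proof.
case: a => [|x a]; first by rewrite cats0.
case: b => [|y b]; first by rewrite cats0.
by rewrite !cat_cons !cycle_sum_split addrC.
Qed.

Lemma cycle_sum_rot i c : cycle_sum (rot i c) = cycle_sum c.
Proof. by rewrite /rot cycle_sum_catC cat_take_drop. Qed.

Lemma not_uniq_split (c : seq V) :
  ~~ uniq c -> exists a y b d, c = a ++ y :: b ++ y :: d.
Proof.
elim: c => //= x c IHc; rewrite negb_and negbK => /orP[|/IHc].
  by case/path.splitPr=> b d; exists [::], x, b, d.
by case=> [a [y [b [d ->]]]]; exists (x :: a), y, b, d.
Qed.

(** A closed walk that repeats a vertex is the concatenation of two shorter
closed walks. One with a chord splits at the two ends of the chord into two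
shorter closed walks, each using the chord once, so that the chord cancels in
characteristic two. What remains is a hole, or a walk of length at most two,
which goes back and forth along one edge. *)
Lemma cycle_sum0 : (forall c, hole c -> cycle_sum c = 0) ->
  forall c, cycle e c -> cycle_sum c = 0.
Proof.
move=> hole0 c; elim: (size c).+1 {-2}c (ltnSn (size c)) => // n IHn {}c.
rewrite ltnS => le_c_n cyc.
have [Uc|/not_uniq_split[a [y [b [d def_c]]]]] := boolP (uniq c); last first.
  rewrite {}def_c in le_c_n cyc *.
  have: cycle e (y :: b ++ y :: (d ++ a)).
    by rewrite -cat_cons -cat_cons catA -rot_size_cat rot_cycle.
  rewrite cycle_split => /andP[cyc1 cyc2].
  rewrite cycle_sum_catC cat_cons -catA cat_cons cycle_sum_split.
  move: le_c_n; rewrite !size_cat /= size_cat /= => le_c_n.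
  rewrite -/(cycle_sum (y :: b)) -/(cycle_sum (y :: (d ++ a))).
  by rewrite !IHn ?addr0 //= ?size_cat; lia.
have [hole_c|] := boolP (hole c); first exact: hole0.
rewrite /hole Uc cyc /= negb_and -leqNgt => /orP[|].
  case: c cyc {le_c_n Uc} => [|x [|y [|z c]]] //=; first by rewrite e_irr.
  by rewrite addr0 (g_sym y) F2_addrr.
case/forall_inPn=> y yc /forall_inPn[z zc]; rewrite negb_imply negb_or.
case/and3P=> eyz nzy nyz.
(* Starting the walk at [y] puts the chord [y z] in the form [y b z d] with *)
(* nonempty [b] and [d], which makes both pieces strictly shorter. *)
have [i q def_c] := rot_to yc.
have nyzE: y != z by apply: contraTneq eyz => ->; rewrite e_irr.
have: z \in q.
  have: z \in rot i c by rewrite mem_rot.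
  by rewrite def_c inE eq_sym (negbTE nyzE).
move=> zq; case/path.splitPr: zq def_c => b d def_c.
move: nzy nyz; rewrite -!(next_rot i Uc) def_c => nzy nyz.
have Uc': uniq (y :: b ++ z :: d) by rewrite -def_c rot_uniq.
have sz_c : size c = (size b + size d).+2.
  by rewrite -(size_rot i) def_c /= size_cat /= addnS.
have b_gt0: (0 < size b)%N.
  by case: b nzy {def_c nyz Uc' sz_c} => //=; rewrite !eqxx.
have d_gt0: (0 < size d)%N.
  case: d {def_c nzy sz_c} nyz Uc' => // nyz Uc'; case/negP: nyz.
  by rewrite -(next_rot (size (y :: b)) Uc') -cat_cons rot_size_cat /= eqxx.
have: cycle e (rot i c) by rewrite rot_cycle.
rewrite def_c cycle_split => /andP[path1 path2].
have /eqP: cycle_sum (y :: rcons b z) + cycle_sum (z :: rcons d y) = 0.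
  rewrite !IHn ?addr0 //= ?size_rcons // ?(rcons_path _ _ (rcons _ _))
          ?last_rcons ?path1 ?path2 //.
  - by move: le_c_n b_gt0; rewrite sz_c; move: (size b) (size d); lia.
  - by move: le_c_n d_gt0; rewrite sz_c; move: (size b) (size d); lia.
  - by rewrite e_sym.
rewrite /= !walk_sum_rcons !last_rcons -/(walk_sum _ _) addrACA (g_sym z).
rewrite F2_addrr addr0 -!walk_sum_rcons -cycle_sum_split -def_c.
by rewrite cycle_sum_rot => /eqP.
Qed.

(** The potential of [v] is the sum along some path from the root of its
component. For an edge [u v], the path to [u], the edge and the reversed path
to [v] form a closed walk. *)
Lemma potential_of_cycle_sum0 : (forall c, cycle e c -> cycle_sum c = 0) ->
  exists d : V -> 'F_2, forall u v, e u v -> g u v = d u + d v.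
Proof.
move=> sum0; have c_sym: connect_sym e by apply: sym_connect_sym.
pose r := fingraph.root e.
have /fin_all_exists[d dP] v : exists a : 'F_2, exists p,
    [/\ path e (r v) p, last (r v) p = v & a = walk_sum (r v) p].
  have: connect e (r v) v by rewrite c_sym /r connect_root.
  by case/connectP=> p path_p def_v; exists (walk_sum (r v) p), p.
exists d => u v euv.
have [p [path_p last_p ->]] := dP u; have [q [path_q last_q ->]] := dP v.
have def_r: r v = r u by apply/esym/eqP; rewrite root_connect // connect1.
rewrite {}def_r in path_q last_q *.
have: walk_sum (r u) (p ++ v :: rev (belast (r u) q)) = 0.
  have pq: path e (r u) (p ++ v :: rev (belast (r u) q)).
    rewrite cat_path path_p last_p /= euv -[in path e v _]last_q rev_path.
    by rewrite (eq_path (e' := e)) // => x y; rewrite e_sym.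
  have lpq: last (r u) (p ++ v :: rev (belast (r u) q)) = r u.
    rewrite last_cat /=; case: q {path_q pq} last_q => //= x q _.
    by rewrite rev_cons last_rcons.
  case/lastP: (_ ++ _) pq lpq => [//|s x] pq; rewrite last_rcons => def_x.
  by rewrite def_x in pq *; apply: (sum0 (r u :: s)).
rewrite walk_sum_cat last_p /= -[in walk_sum v _]last_q walk_sum_rev addrCA addrA.
move/eqP; rewrite -addrA addr_eq0 => /eqP->.
by rewrite -[- _]addr0 -(F2_addrr (walk_sum (r u) p + walk_sum (r u) q))
           addrA addNr add0r.
Qed.

Lemma cycle_sumE c : uniq c -> cycle_sum c = \sum_(x <- c) g x (next c x).
Proof.
case: c => [|x0 q] Uc; first by rewrite big_nil.
have walkE: forall x p, walk_sum x p =
    \sum_(0 <= i < size p) g (nth x0 (x :: p) i) (nth x0 p i).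
  move=> x p; elim: p x => [|y p IHp] x /=; first by rewrite big_nil.
  by rewrite big_nat_recl //= IHp.
rewrite (big_nth x0) /cycle_sum walkE size_rcons.
apply: eq_big_nat => i /andP[_ lti].
rewrite next_nth -rcons_cons nth_rcons lti; congr (g _ _).
by rewrite mem_nth // index_uniq // nth_rcons_default.
Qed.

Lemma hole_potential :
  (forall c, hole c -> \sum_(x <- c) g x (next c x) = 0) ->
  exists d : V -> 'F_2, forall u v, e u v -> g u v = d u + d v.
Proof.
move=> hole0; apply/potential_of_cycle_sum0/cycle_sum0 => c hole_c.
by rewrite cycle_sumE ?hole0 //; case/and4P: hole_c.
Qed.

End Walks.

(** * Holes as induced cycles of the graph *)

Section CycleSeq.
Variables (T : eqType) (c : seq T).
Hypotheses (c_gt2 : (2 < size c)%N) (Uc : uniq c).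

Lemma next_neq x : x \in c -> next c x != x.
Proof.
case/rot_to=> i q def_c; rewrite -(next_rot i Uc) def_c.
have: uniq (x :: q) by rewrite -def_c rot_uniq.
have: (2 < size (x :: q))%N by rewrite -def_c size_rot.
case: q {def_c} => //= y q _; rewrite eqxx inE negb_or eq_sym.
by case/andP=> /andP[].
Qed.

Lemma next_next_neq x : x \in c -> next c (next c x) != x.
Proof.
case/rot_to=> i q def_c; rewrite -!(next_rot i Uc) def_c.
have: uniq (x :: q) by rewrite -def_c rot_uniq.
have: (2 < size (x :: q))%N by rewrite -def_c size_rot.
case: q {def_c} => [|y [|z q]] //= _; rewrite !inE !negb_or eqxx.
case/andP=> /and3P[xy xz _] _; rewrite eqxx eq_sym.
by case: eqVneq xy; rewrite /= 1?eq_sym.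
Qed.

End CycleSeq.

Section Graph.
Variables (V : finType) (G : sgraph V).
Implicit Types (w : {set V} -> 'F_2) (c : seq V) (S : {set V}).

Definition adj (u v : V) : bool := [set u; v] \in edges G.

Lemma adj_sym : symmetric adj.
Proof. by move=> u v; rewrite /adj setUC. Qed.

Lemma adj_irr : irreflexive adj.
Proof.
move=> u; apply/negP=> /edges_card2/eqP.
by rewrite setUid cards1.
Qed.

Lemma edgeP e : e \in edges G -> exists u v, u != v /\ e = [set u; v].
Proof. by move/edges_card2/eqP/cards2P=> [u [v [uv ->]]]; exists u, v. Qed.

(** A hole of the subgraph induced on [S] is a hole of the graph inside [S]. *)
Lemma hole_potential_in w S :
    (forall c, hole adj c -> {subset c <= S} ->
       \sum_(x <- c) w [set x; next c x] = 0) ->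
  exists d : V -> 'F_2, forall u v, u \in S -> v \in S -> adj u v ->
    w [set u; v] = d u + d v.
Proof.
move=> hole0; pose adjS u v := [&& u \in S, v \in S & adj u v].
have [||||d dP] := @hole_potential V adjS (fun u v => w [set u; v]).
- by move=> u v; rewrite /adjS adj_sym andbCA.
- by move=> u; rewrite /adjS adj_irr !andbF.
- by move=> u v; rewrite setUC.
- move=> c /and4P[c_gt2 Uc cyc chordless].
  have cS : {subset c <= S}.
    by move=> x xc; have /and3P[] := next_cycle cyc xc.
  apply: hole0 => //; apply/and4P; split => //.
    by apply: sub_cycle cyc => u v /and3P[].
  apply/forall_inP=> x xc; apply/forall_inP=> y yc; apply/implyP=> axy.
  have /forall_inP/(_ x xc)/forall_inP/(_ y yc)/implyP := chordless.
  by apply; rewrite /adjS !cS.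
by exists d => u v uS vS auv; apply: dP; rewrite /adjS uS vS.
Qed.

(** The sum is that of [d v] counted once per edge of the cycle at [v], and all
degrees are even. *)
Lemma sum_potential_even H w (d : V -> 'F_2) : is_cycle G H ->
    (forall u v, [set u; v] \in H.2 -> w [set u; v] = d u + d v) ->
  \sum_(e in H.2) w e = 0.
Proof.
case/and3P=> /andP[/subsetP HG /forall_inP HV] _ /forall_inP even_deg dP.
transitivity (\sum_(e in H.2) \sum_(v in e) d v).
  apply: eq_bigr => e eH; have [u [v [uv def_e]]] := edgeP (HG e eH).
  by rewrite def_e in eH *; rewrite dP // big_setU1 ?inE ?big_set1.
rewrite (exchange_big_dep predT) //= big1 // => v _.
have -> : \sum_(e in H.2 | v \in e) d v = d v *+ degree H.2 v.
  by rewrite -sumr_const; apply: eq_bigl => e; rewrite inE.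
have even_v : ~~ odd (degree H.2 v).
  have [/even_deg //|vH] := boolP (v \in H.1).
  rewrite /degree (_ : [set e in H.2 | v \in e] = set0) ?cards0 //.
  apply/setP=> e; rewrite !inE; apply/negP=> /andP[/HV/subsetP eV ve].
  by rewrite eV in vH.
by rewrite -[degree _ _]odd_double_half (negbTE even_v) -mul2n mulrnA mulr2n
     F2_addrr mul0rn.
Qed.

Definition seq_cycle c : {set V} * {set {set V}} :=
  ([set x in c], [set [set x; next c x] | x in c]).

Section Hole.
Variables (c : seq V) (hole_c : hole adj c).

Let c_gt2 : (2 < size c)%N. Proof. by case/and4P: hole_c. Qed.
Let Uc : uniq c. Proof. by case/and4P: hole_c. Qed.
Let cyc : cycle adj c. Proof. by case/and4P: hole_c. Qed.

(** Length at least three excludes that an edge is traversed both from [x] to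
[y] and from [y] to [x]. *)
Lemma next_edge_inj : {in c &, injective (fun x => [set x; next c x])}.
Proof.
move=> x y xc yc /= eq_xy.
have : x \in [set y; next c y] by rewrite -eq_xy set21.
rewrite !inE => /orP[/eqP // | /eqP def_x].
have : y \in [set x; next c x] by rewrite eq_xy set21.
rewrite !inE => /orP[/eqP // | /eqP def_y].
by have := next_next_neq c_gt2 Uc xc; rewrite -def_y -def_x eqxx.
Qed.

Lemma sum_seq_cycle w :
  \sum_(e in (seq_cycle c).2) w e = \sum_(x <- c) w [set x; next c x].
Proof. by rewrite big_imset ?big_uniq //; apply: next_edge_inj. Qed.

Lemma seq_cycle_length : cycle_length (seq_cycle c) = size c.
Proof.
by rewrite /cycle_length card_in_imset ?(card_uniqP Uc) //; apply: next_edge_inj.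
Qed.

Lemma seq_cycle_degree x : x \in c -> degree (seq_cycle c).2 x = 2.
Proof.
move=> xc; have pxc : prev c x \in c by rewrite mem_prev.
rewrite /degree (_ : [set e in _ | _] =
  [set [set x; next c x]; [set prev c x; next c (prev c x)]]).
  rewrite cards2; case: eqP => // /next_edge_inj => /(_ xc pxc) def_x.
  by have := next_neq c_gt2 Uc xc; rewrite {1}def_x next_prev // eqxx.
apply/setP=> e; rewrite !inE; apply/andP/idP=> [[/imsetP[y yc ->]]|].
  by rewrite !inE => /orP[]/eqP->; rewrite ?prev_next // eqxx ?orbT.
case/orP=> /eqP->; split; rewrite ?next_prev // ?set21 ?set22 //.
  exact: imset_f.
by apply/imsetP; exists (prev c x); rewrite ?next_prev.
Qed.

Lemma seq_cycle_induced : induced_cycle G (seq_cycle c).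
Proof.
have conn : connected_by (seq_cycle c).1 (seq_cycle c).2.
  apply/andP; split.
    case: c c_gt2 => //= x q _; apply/set0Pn; exists x.
    by rewrite inE mem_head.
  apply/forall_inP=> x; rewrite inE => xc.
  apply/forall_inP=> y; rewrite inE => yc.
  have : fconnect (next c) x y by rewrite (fconnect_cycle (cycle_next Uc)).
  case/connectP=> p path_p ->; apply/connectP; exists p => //.
  elim: p x xc path_p {yc} => //= z p IHp x xc /andP[/eqP <- path_p].
  by rewrite IHp ?mem_next // andbT; apply: imset_f.
have degV : [set v in (seq_cycle c).1 | degree (seq_cycle c).2 v != 0%N]
              = (seq_cycle c).1.
  apply/setP=> x; rewrite !inE; case: (boolP (x \in c)) => //= xc.
  by rewrite seq_cycle_degree.
apply/andP; split.
  rewrite /simple_cycle degV conn andbT; apply/andP; split; last first.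
    by apply/forall_inP=> x; rewrite inE => xc; rewrite seq_cycle_degree.
  apply/and3P; split=> //; last first.
    by apply/forall_inP=> x; rewrite inE => xc; rewrite seq_cycle_degree.
  apply/andP; split.
    by apply/subsetP=> e /imsetP[x xc ->]; apply: next_cycle cyc xc.
  apply/forall_inP=> e /imsetP[x xc ->]; apply/subsetP=> y.
  by rewrite !inE => /orP[]/eqP->; rewrite ?mem_next.
apply/forall_inP=> e eG; apply/implyP=> /subsetP eS.
have [u [v [uv def_e]]] := edgeP eG; rewrite def_e in eG eS *.
have [uc vc] : u \in c /\ v \in c.
  by split; [have := eS u | have := eS v]; rewrite !inE eqxx ?orbT;
     move=> /(_ isT)/andP[].
have /and4P[_ _ _ /forall_inP/(_ u uc)] := hole_c.
move=> /forall_inP/(_ v vc)/implyP/(_ eG).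
by case/orP=> /eqP->; [|rewrite setUC]; apply/imsetP; [exists u | exists v].
Qed.

End Hole.

(** Handshake: the degrees, all equal to two, add up to at most twice the number
of edges. *)
Lemma simple_cycle_card H :
  simple_cycle G H ->
  (#|[set v in H.1 | degree H.2 v != 0%N]| <= cycle_length H)%N.
Proof.
set W := [set v in _ | _].
case/and3P=> /and3P[/andP[/subsetP HG _] _ _] /forall_inP deg2 _.
rewrite -(leq_pmul2r (isT : 0 < 2)%N) -!sum_nat_const.
rewrite -(eq_bigr _ (fun v vW => eqP (deg2 v vW))).
rewrite (eq_bigr (fun v => \sum_(e in H.2 | v \in e) 1)%N); last first.
  by move=> v _; rewrite -[degree _ _]sum1_card; apply: eq_bigl => e; rewrite inE.
rewrite (exchange_big_dep (mem H.2)) /=; last by move=> ? ? _ /andP[].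
apply: leq_sum => e eH; rewrite sum1_card -(edges_card2 (HG e eH)).
by apply: subset_leq_card; apply/subsetP=> v /and3P[].
Qed.

Lemma cycle_edge_support H u v : is_cycle G H -> [set u; v] \in H.2 ->
  u \in [set v in H.1 | degree H.2 v != 0%N].
Proof.
case/and3P=> /andP[_ /forall_inP HV] _ _ uvH; rewrite inE.
have /subsetP-> //= := HV _ uvH; last by rewrite set21.
by rewrite -lt0n; apply/card_gt0P; exists [set u; v]; rewrite inE uvH set21.
Qed.

End Graph.

(** * Duality in the edge space and the cycle sparsity *)

(** Bases of a span can be chosen inside the spanning family; stated for an
indexed family in order to keep track of the index of each basis vector. *)
Lemma free_subfamily (K : fieldType) (vT : vectType K) (T : eqType)
    (f : T -> vT) (s : seq T) :
  exists s', [/\ {subset s' <= s}, free (map f s')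
                & (<<map f s'>> = <<map f s>>)%VS].
Proof.
elim: s => [|x s [s' [sub_s' free_s' span_s']]].
  by exists [::]; split=> //; rewrite /free span_nil dimv0.
have [fx|fx] := boolP (f x \in <<map f s'>>%VS); last first.
  exists (x :: s'); split.
  - move=> y; rewrite !inE => /orP[-> // | /sub_s' ->]; exact: orbT.
  - by rewrite /= free_cons fx.
  - by rewrite /= !span_cons span_s'.
exists s'; split=> // [y /sub_s'|]; first by rewrite inE orbC => ->.
rewrite /= span_cons -span_s'; apply/esym/addv_idPr.
by rewrite -memvE.
Qed.

Section Sparsity.
Variables (V : finType) (G : sgraph V).
Implicit Types (w : {set V} -> 'F_2) (H : {set V} * {set {set V}}).
Local Notation edge_space := {ffun edge G -> ('F_2)^o}.

Definition pairing w (f : edge_space) : ('F_2)^o :=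
  \sum_e (f e : 'F_2) * w (val e) : 'F_2.

Lemma pairing_is_linear w : linear (pairing w).
Proof.
move=> a f h; rewrite /pairing.
transitivity ((a * \sum_e (f e : 'F_2) * w (val e) +
               \sum_e (h e : 'F_2) * w (val e)) : 'F_2) => //.
rewrite mulr_sumr -big_split; apply: eq_bigr => e _.
by rewrite /= mulrA -mulrDl !ffunE.
Qed.

HB.instance Definition _ w :=
  GRing.isLinear.Build 'F_2 edge_space ('F_2)^o *:%R (pairing w)
    (pairing_is_linear w).

Lemma pairing_incidence w H : is_cycle G H ->
  pairing w (incidence G H) = \sum_(e in H.2) w e.
Proof.
case/and3P=> /andP[/subsetP HG _] _ _.
rewrite /pairing [RHS](eq_bigl (fun e => (e \in edges G) && (e \in H.2))).
  2: by move=> e; rewrite andb_idl //; apply: HG.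
rewrite big_mkcondr /= [RHS]big_sub; apply: eq_bigr => e _; rewrite ffunE.
by case: ifP; rewrite (mul1r, mul0r).
Qed.

(** The map [f |-> f - projv U f] kills [U] but not [x]; one of its coordinates
[e0] gives a linear form, and every linear form on the edge space is the pairing
with its values on the unit vectors. *)
Lemma separating_weight (U : {vspace edge_space}) (x : edge_space) :
  x \notin U ->
  exists w, (forall u, u \in U -> pairing w u = 0) /\ pairing w x != 0.
Proof.
move=> xU.
have [e0 xe0] : exists e0, (x - projv U x) e0 != 0.
  apply/existsP; apply: contraR xU; rewrite negb_exists => /forallP x0.
  suff -> : x = projv U x by apply: memv_proj.
  apply/eqP; rewrite -subr_eq0; apply/eqP/ffunP=> e.
  by move: (x0 e); rewrite negbK => /eqP->; rewrite !ffunE.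
pose delta (e : edge G) : edge_space := [ffun e' => (e' == e)%:R].
pose w (s : {set V}) : 'F_2 :=
  if insub s is Some e then (delta e - projv U (delta e)) e0 else 0.
have wE f : pairing w f = (f - projv U f) e0.
  have f_sum : f = \sum_e f e *: delta e.
    apply/ffunP=> e; rewrite sum_ffunE (bigD1 e) //= big1 ?addr0 => [|e' ne'].
      by rewrite !ffunE eqxx /GRing.scale /= mulr1.
    by rewrite !ffunE eq_sym (negbTE ne') scaler0.
  rewrite [in RHS]f_sum raddf_sum -sumrB sum_ffunE; apply: eq_bigr => e _.
  by rewrite /w valK /= linearZ -scalerBr [RHS]ffunE.
exists w; split=> [u uU|]; rewrite wE //.
by rewrite projv_id // subrr ffunE.
Qed.

Definition short_induced (l : nat) : pred ({set V} * {set {set V}}) :=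
  [pred H | induced_cycle G H && (cycle_length H <= l)%N].

Definition short_space (l : nat) : {vspace edge_space} :=
  <<[seq incidence G H | H <- enum (short_induced l)]>>%VS.

Lemma simple_is_cycle H : simple_cycle G H -> is_cycle G H.
Proof. by case/and3P. Qed.

Lemma incidence_cycle_space H : is_cycle G H -> incidence G H \in cycle_space G.
Proof. by move=> cycH; apply/memv_span/map_f; rewrite mem_enum. Qed.

Lemma short_basis_span l l' : (l <= l')%N ->
  has_short_induced_basis G l -> (cycle_space G <= short_space l')%VS.
Proof.
move=> le_l [s [/andP[_ /andP[/eqP <- _]] /allP ind /allP short]].
apply: sub_span => _ /mapP[H Hs ->]; apply: map_f.
by rewrite mem_enum inE ind //= (leq_trans (short _ Hs)).
Qed.

Lemma short_span_basis l :
  (cycle_space G <= short_space l)%VS -> has_short_induced_basis G l.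
Proof.
move=> le_cs.
have [s [sub_s free_s span_s]] :=
  free_subfamily (@incidence V G) (enum (short_induced l)).
have sP H : H \in s -> induced_cycle G H && (cycle_length H <= l)%N.
  by move/sub_s; rewrite mem_enum.
exists s; split; first last.
- by apply/allP=> H /sP/andP[].
- by apply/allP=> H /sP/andP[].
apply/andP; split; first by apply/allP=> H /sP/andP[/andP[]].
rewrite /basis_of free_s andbT eqEsubv; apply/andP; split; last by rewrite span_s.
apply/span_subvP=> _ /mapP[H /sP/andP[/andP[/simple_is_cycle cycH _] _] ->].
exact: incidence_cycle_space.
Qed.

Definition vanishing l w :=
  forall H, induced_cycle G H -> (cycle_length H <= l)%N ->
    \sum_(e in H.2) w e = 0.

Definition has_potential w :=
  exists d : V -> 'F_2, forall u v, adj G u v -> w [set u; v] = d u + d v.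

(** Left to right, a weight that vanishes on the short induced cycles vanishes on
the whole cycle space, in particular on all holes. Right to left, a cycle
outside the span would be separated from it by a weight that vanishes on the
short induced cycles but, having a potential, also on that cycle. *)
Lemma short_spanP l :
  (cycle_space G <= short_space l)%VS <->
  (forall w, vanishing l w -> has_potential w).
Proof.
split=> [le_cs w w0 | pot].
  have cycle0 H : is_cycle G H -> \sum_(e in H.2) w e = 0.
    move=> cycH; rewrite -pairing_incidence //.
    suff: incidence G H \in lker (linfun (pairing w)).
      by rewrite memv_ker lfunE => /eqP.
    apply: (subvP (subv_trans le_cs _)); last exact: incidence_cycle_space.
    apply/span_subvP=> _ /mapP[H' + ->]; rewrite mem_enum => /andP[indH' lenH'].
    rewrite memv_ker lfunE /= pairing_incidence ?w0 //.
    by case/andP: indH' => /simple_is_cycle.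
  have [c hole_c _|d dP] := @hole_potential_in V G w setT.
    rewrite -(sum_seq_cycle hole_c) cycle0 //.
    by case/andP: (seq_cycle_induced hole_c) => /simple_is_cycle.
  by exists d => u v; apply: dP; rewrite inE.
apply/span_subvP=> _ /imageP[H cycH ->]; apply: contraT => /separating_weight.
case=> w [wU]; rewrite pairing_incidence //; case/eqP.
have [H' indH' lenH'|d dP] := pot w.
  rewrite -pairing_incidence; first last.
    by case/andP: indH' => /simple_is_cycle.
  by apply/wU/memv_span/map_f; rewrite mem_enum inE indH'.
apply: (sum_potential_even cycH (d := d)) => u v uvH; apply: dP.
by case/and3P: cycH => /andP[/subsetP HG _] _ _; apply: HG.
Qed.

(** No cycle is longer than the number of edges of the graph, so with that bound
all holes are allowed and the induced cycles span. This rules out the default value of [cycle_sparsity]. *)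
Lemma has_some_short_basis : exists l, `[< has_short_induced_basis G l >].
Proof.
exists #|edges G|; apply/asboolP/short_span_basis/short_spanP => w w0.
have [c hole_c _|d dP] := @hole_potential_in V G w setT.
  have indc := seq_cycle_induced hole_c.
  rewrite -(sum_seq_cycle hole_c) w0 // subset_leq_card //.
  by case/andP: indc => /simple_is_cycle/and3P[/andP[]].
by exists d => u v; apply: dP; rewrite inE.
Qed.

(** The bound [2 <= l] covers the convention for forests. *)
Lemma cycle_sparsity_leP l : (2 <= l)%N ->
  (cycle_sparsity G <= l)%N <-> (forall w, vanishing l w -> has_potential w).
Proof.
move=> l2; rewrite -short_spanP /cycle_sparsity.
case: eqP => [->|_]; first by rewrite sub0v; split.
case: pselect => [exl|]; last by case; apply: has_some_short_basis.
case: ex_minnP => m /asboolP basis_m min_m.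
split=> [le_ml|/short_span_basis basis_l].
  exact: short_basis_span basis_m.
by apply/min_m/asboolP.
Qed.

End Sparsity.

(** * Determinants of matrices with cyclic support *)

Section Determinants.
Variables (R : realFieldType) (n : nat).
Implicit Types (A B : 'M[R]_n) (s : 'S_n).

(** The entries at a transposed pair [{i, s i}] multiply to a square. *)
Lemma prod_involution A s : A^T = A -> (forall i, s (s i) = i) ->
  \prod_i A i (s i) =
    \prod_(i | s i == i) A i i * \prod_(i : 'I_n | (i < s i)%N) A i (s i) ^+ 2.
Proof.
move=> symA invs; rewrite (bigID (fun i => s i == i)) /=.
congr (_ * _); first by apply: eq_bigr => i /eqP->.
rewrite (bigID (fun i : 'I_n => (i < s i)%N)) /=.
rewrite (eq_bigl (fun i : 'I_n => (i < s i)%N)); last first.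
  by move=> i; rewrite -val_eqE; case: ltngtP.
rewrite [X in _ * X](reindex_inj (@perm_inj _ s)) /=.
rewrite [X in _ * X](eq_bigl (fun i : 'I_n => (i < s i)%N)); last first.
  by move=> i; rewrite invs -!val_eqE /=; case: ltngtP.
rewrite -big_split; apply: eq_bigr => i _ /=.
by rewrite invs -[in A (s i) i]symA mxE expr2.
Qed.

Section Cyclic.
Variable r : 'S_n.
Hypothesis rr : forall i, r (r i) != i.
Hypothesis r_trans : forall i j, exists k, j = iter k r i.

(* Every point stays or moves by one step, in either direction, along the cycle *)
(* [r]. *)
Let neighbour (t : 'S_n) := forall i, [|| t i == i, t i == r i | i == r (t i)].

(** Once [t] has moved [i] one step forward without swapping it with [r i], it
can neither fix [r i], whose preimage is already [i], nor send it back; so [t]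
moves forward all along the cycle. *)
Lemma neighbour_perm_rigid (t : 'S_n) i : neighbour t ->
  t i = r i -> t (t i) != i -> t = r.
Proof.
move=> tP ti tti; apply/perm.permP=> j; have [k {j}->] := r_trans i j.
suff [] : t (iter k r i) = r (iter k r i) /\
          t (r (iter k r i)) != iter k r i by [].
elim: k => [|k [IH1 IH2]] /=; first by rewrite -ti.
set j := iter k r i in IH1 IH2 *.
have trj : t (r j) = r (r j).
  case/or3P: (tP (r j)) => /eqP // E.
    have rj : r j = j by apply: (@perm_inj _ t); rewrite E IH1.
    by case/eqP: (rr j); rewrite !rj.
  by case/eqP: IH2; apply: (@perm_inj _ r); rewrite -E.
by split=> //; rewrite -[X in _ != X]IH1 (inj_eq perm_inj).
Qed.

(** A point on a cycle of [s] of length at least three is moved one step forward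
by [s] or by its inverse, and [neighbour_perm_rigid] applies to that one. *)
Lemma neighbour_perm (s : 'S_n) : neighbour s ->
  [\/ forall i, s (s i) = i, s = r | s = (r^-1)%g].
Proof.
move=> sP; have [/forallP inv|] := boolP [forall i, s (s i) == i].
  by apply: Or31 => i; apply/eqP.
rewrite negb_forall => /existsP[i ssi].
have si : s i != i by apply: contraNneq ssi => E; rewrite !E.
have := sP i; rewrite (negbTE si) /= => /orP[]/eqP def_si.
  by apply: Or32; apply: neighbour_perm_rigid ssi.
apply: Or33; rewrite -[s]invgK; congr (_^-1)%g.
apply: (@neighbour_perm_rigid _ (s i)).
- move=> x; move: (sP (s^-1 x)%g); rewrite permKV eq_sym.
  by case/or3P=> E; rewrite E ?orbT.
- by rewrite permK.
- by rewrite permK -(inj_eq (@perm_inj _ s)) permKV eq_sym.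
Qed.

(** In the Leibniz expansion the involutions contribute the same to [\det A] and
[\det B] because they only involve diagonal and squared entries. The terms of
[r] and [r^-1] are equal by symmetry and do not cancel, since both permutations
have the same sign. *)
Lemma det_cyclic_support A B (i0 : 'I_n) : A^T = A -> B^T = B ->
    (forall i, B i i = A i i) -> (forall i j, B i j ^+ 2 = A i j ^+ 2) ->
    (forall i j, A i j != 0 -> [|| j == i, j == r i | i == r j]) ->
    \det B = \det A ->
  \prod_i B i (r i) = \prod_i A i (r i).
Proof.
move=> symA symB diagAB sqrAB suppA.
have rV : (r^-1)%g != r.
  by apply: contra_neq (rr i0) => E; rewrite -{1}E permK.
have prodV (C : 'M[R]_n) : C^T = C ->
    \prod_i C i ((r^-1)%g i) = \prod_i C i (r i).
  move=> symC; rewrite (reindex_inj (@perm_inj _ r)); apply: eq_bigr => i _.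
  by rewrite permK -[in LHS]symC mxE.
have detE (C : 'M[R]_n) : C^T = C -> \det C =
    ((-1) ^+ r * \prod_i C i (r i)) *+ 2 +
    \sum_(s | (s != r) && (s != (r^-1)%g)) (-1) ^+ s * \prod_i C i (s i).
  move=> symC; rewrite /determinant (bigD1 r) //= (bigD1 (r^-1)%g) //=.
  by rewrite prodV // odd_permV addrA -mulr2n.
rewrite !detE // [X in _ + X = _](_ : _ =
    \sum_(s | (s != r) && (s != (r^-1)%g)) (-1) ^+ s * \prod_i A i (s i)).
  move/addIr/eqP; rewrite eqr_pMn2r // => /eqP.
  by apply: mulfI; rewrite signr_eq0.
apply: eq_bigr => s /andP[/eqP sr /eqP srV]; congr (_ * _).
have [/eqP A0|] := boolP (\prod_i A i (s i) == 0).
  rewrite A0; apply/eqP; move/eqP: A0; rewrite -!(sqrf_eq0 (\prod_i _ )).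
  by rewrite -!prodrXl; under [in X in _ -> X]eq_bigr do rewrite sqrAB.
move/prodf_neq0 => nzA.
case: (@neighbour_perm s) => // [i|inv]; first exact/suppA/nzA.
rewrite !prod_involution //; congr (_ * _); first by apply: eq_bigr.
by apply: eq_bigr.
Qed.

End Cyclic.
End Determinants.

(** * Signs, principal minors and the equivalence *)

Section Sign.
Variable R : realDomainType.

Definition sign (x : 'F_2) : R := (-1) ^+ (x : nat).

Lemma signD x y : sign (x + y) = sign x * sign y.
Proof. by rewrite /sign -exprD -[in RHS]signr_odd -modn2. Qed.

Lemma sign0 : sign 0 = 1. Proof. by []. Qed.

Lemma sign_sqr x : sign x ^+ 2 = 1.
Proof. exact: sqrr_sign. Qed.

Lemma sign_sum (I : Type) (s : seq I) (F : I -> 'F_2) :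
  \prod_(i <- s) sign (F i) = sign (\sum_(i <- s) F i).
Proof. by symmetry; apply: (big_morph sign signD sign0). Qed.

Lemma sign_cases x : (x = 0 /\ sign x = 1) \/ (x = 1 /\ sign x = -1).
Proof.
case: x => [[|[|//]] ltx]; [left | right].
  by split; [apply/val_inj | ].
by split; [apply/val_inj | rewrite /sign /= expr1].
Qed.

Lemma sign_inj : injective sign.
Proof.
have n1 : (1 : R) != -1 by rewrite -subr_eq0 opprK (pnatr_eq0 R 2).
by move=> x y; case: (sign_cases x) => [[-> ->]|[-> ->]];
  case: (sign_cases y) => [[-> ->]|[-> ->]] // E; case/eqP: n1.
Qed.

End Sign.

Section Minors.
Variables (R : realType) (N : nat).
Implicit Types (K : 'M[R]_N) (S : {set 'I_N}).

(** Principal minors may be computed with any enumeration of the index set, as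
row and column permutations contribute the same sign. *)
Lemma principal_minorE K S n (f : 'I_n -> 'I_N) :
  injective f -> (forall x, (x \in S) = (x \in codom f)) ->
  \det (principal_submx K S) = \det (mxsub f f K).
Proof.
move=> inj_f Sf.
have defn : n = #|S|.
  by rewrite (eq_card Sf) card_codom // card_ord.
subst n.
have fS i : f i \in S by rewrite Sf codom_f.
pose h i := enum_rank_in (fS i) (f i).
have hE i : enum_val (h i) = f i by rewrite enum_rankK_in.
have inj_h : injective h by move=> i j /(congr1 enum_val); rewrite !hE => /inj_f.
have -> : mxsub f f K =
    row_perm (perm inj_h) (col_perm (perm inj_h) (principal_submx K S)).
  by apply/matrixP=> i j; rewrite !mxE !permE -!hE.
rewrite row_permE col_permE !det_mulmx !det_perm odd_permV mulrCA.
by rewrite -signr_addb addbb mulr1.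
Qed.

Lemma principal_minor1 K i : \det (principal_submx K [set i]) = K i i.
Proof.
rewrite (@principal_minorE K _ 1 (fun=> i)).
- by rewrite det_mx11 mxE.
- by move=> x y _; rewrite !ord1.
- move=> x; rewrite inE; apply/idP/idP=> [/eqP->|/codomP[_ ->]]; last exact: eqxx.
  by apply/codomP; exists ord0.
Qed.

Lemma principal_minor2 K i j : i != j ->
  \det (principal_submx K [set i; j]) = K i i * K j j - K i j * K j i.
Proof.
move=> ij; rewrite (@principal_minorE K _ 2 (fun k => if k == ord0 then i else j)).
- rewrite (expand_det_row _ ord0) !big_ord_recl big_ord0 addr0 /cofactor !det_mx11.
  by rewrite !mxE /= expr0 mul1r expr1 mulN1r mulrN.
- move=> [[|[|//]] ltx] [[|[|//]] lty] //= E; apply/val_inj => //=.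
  + by rewrite E eqxx in ij.
  + by rewrite E eqxx in ij.
- move=> x; rewrite !inE; apply/idP/idP=> [/orP[]/eqP->|/codomP[k ->]].
  + by apply/codomP; exists ord0.
  + by apply/codomP; exists ord_max.
  + by apply/orP; case: (k == ord0); rewrite eqxx; [left | right].
Qed.

(** The successor on the hole is the cyclic permutation [r] of
[det_cyclic_support], and chordlessness is the condition on the support. *)
Lemma hole_minor K K' c : K^T = K -> K'^T = K' ->
    (forall i, K' i i = K i i) -> (forall i j, K' i j ^+ 2 = K i j ^+ 2) ->
    hole (adj (graph_of_mx K)) c ->
    \det (principal_submx K' [set x in c]) =
      \det (principal_submx K [set x in c]) ->
  \prod_(x <- c) K' x (next c x) = \prod_(x <- c) K x (next c x).
Proof.
move=> symK symK' diagE sqrE hole_c detE.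
have /and4P[c_gt2 Uc cyc /forall_inP chordless] := hole_c.
pose S := [set x in c]; have inS x : (x \in S) = (x \in c) by rewrite inE.
have cS (i : 'I_#|S|) : enum_val i \in c by rewrite -inS enum_valP.
have nS (i : 'I_#|S|) : next c (enum_val i) \in S by rewrite inS mem_next.
pose h i := enum_rank_in (nS i) (next c (enum_val i)).
have hE i : enum_val (h i) = next c (enum_val i) by rewrite enum_rankK_in.
have inj_h : injective h.
  move=> i j /(congr1 enum_val); rewrite !hE => /(can_inj (prev_next Uc)).
  exact: enum_val_inj.
pose r := perm inj_h; have rE i : enum_val (r i) = next c (enum_val i).
  by rewrite permE hE.
have prodE (L : 'M[R]_N) : \prod_(x <- c) L x (next c x) =
    \prod_i (principal_submx L S) i (r i).
  transitivity (\prod_(x in S) L x (next c x)).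
    by rewrite big_uniq //; apply: eq_bigl => x; rewrite inS.
  by rewrite big_enum_val; apply: eq_bigr => i _; rewrite mxE rE.
have /card_gt0P[x0 x0c] : (0 < #|S|)%N.
  by rewrite cardsE (card_uniqP Uc) (ltn_trans _ c_gt2).
rewrite !prodE.
apply: (det_cyclic_support _ _ (enum_rank_in x0c x0) _ _ _ _ _ detE).
- by move=> i; rewrite -(inj_eq enum_val_inj) !rE next_next_neq.
- move=> i j; have : fconnect (next c) (enum_val i) (enum_val j).
    by rewrite (fconnect_cycle (cycle_next Uc)).
  move/iter_findex=> def_j; exists (findex (next c) (enum_val i) (enum_val j)).
  apply: enum_val_inj; rewrite -{1}def_j; elim: (findex _ _ _) => //= k ->.
  by rewrite rE.
- by apply/matrixP=> i j; rewrite !mxE -{1}symK mxE.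
- by apply/matrixP=> i j; rewrite !mxE -{1}symK' mxE.
- by move=> i; rewrite !mxE.
- by move=> i j; rewrite !mxE.
- move=> i j; rewrite mxE => Kij; case: eqP => //= /eqP ji.
  rewrite -(inj_eq enum_val_inj) -[X in _ || X](inj_eq enum_val_inj) !rE.
  have /forall_inP/(_ _ (cS j))/implyP := chordless _ (cS i).
  by apply; rewrite /adj graph_of_mxE // (inj_eq enum_val_inj) eq_sym.
Qed.

End Minors.

Section Main.
Variables (R : realType) (N : nat) (K : 'M[R]_N).
Hypothesis symK : K^T = K.
Implicit Types (w : {set 'I_N} -> 'F_2) (l : nat).
Local Notation G := (graph_of_mx K).
Local Notation sgn := (sign R).

Lemma mx_symE (L : 'M[R]_N) i j : L^T = L -> L j i = L i j.
Proof. by move=> symL; rewrite -[in LHS]symL mxE. Qed.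

Definition switch w : 'M[R]_N :=
  \matrix_(i, j) if i == j then K i i else sgn (w [set i; j]) * K i j.

(** On [S] the switched matrix is the conjugate of [K] by the diagonal sign
matrix of the potential. *)
Lemma switch_minor w (d : 'I_N -> 'F_2) (S : {set 'I_N}) :
    (forall u v, u \in S -> v \in S -> adj G u v -> w [set u; v] = d u + d v) ->
  \det (principal_submx (switch w) S) = \det (principal_submx K S).
Proof.
move=> dP; pose D : 'rV[R]_#|S| := \row_i sgn (d (enum_val i)).
have -> : principal_submx (switch w) S =
    diag_mx D *m principal_submx K S *m diag_mx D.
  apply/matrixP=> i j; rewrite mul_mx_diag mxE mul_diag_mx !mxE.
  case: eqP => [/enum_val_inj -> | /eqP ij].
    by rewrite mulrAC -expr2 sign_sqr mul1r.
  have [->|Kij] := eqVneq (K (enum_val i) (enum_val j)) 0.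
    by rewrite !(mulr0, mul0r).
  rewrite dP ?enum_valP //; last by rewrite /adj graph_of_mxE.
  by rewrite signD mulrAC.
rewrite !det_mulmx mulrAC -det_mulmx (_ : _ *m _ = 1%:M) ?det1 ?mul1r //.
apply/matrixP=> i j; rewrite mul_diag_mx !mxE; case: eqP => [->|_].
  by rewrite -expr2 sign_sqr.
by rewrite mulr0.
Qed.

(** The switched matrix has the minors of [K] up to size [l], because a hole
inside [S] is an induced cycle of length at most [#|S|]; the diagonal matrix
that determination provides is then read as a potential. *)
Lemma potential_of_determined l : determined_by_minors K l ->
  forall w, vanishing G l w -> has_potential G w.
Proof.
move=> detK w w0.
have [||D [[dgD D1] defK']] := detK (switch w).
- apply/matrixP=> i j; rewrite !mxE eq_sym setUC (mx_symE _ _ symK).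
  by case: eqP => // ->.
- move=> S /andP[_ le_S_l].
  have [c hole_c cS|d dP] := @hole_potential_in _ G w S; last exact: switch_minor dP.
  rewrite -(sum_seq_cycle hole_c) w0 ?(seq_cycle_induced hole_c) //.
  rewrite (seq_cycle_length hole_c).
  apply: leq_trans le_S_l; have /and4P[_ Uc _ _] := hole_c.
  by rewrite -(card_uniqP Uc); apply/subset_leq_card/subsetP.
exists (fun i => if D i i == 1 then 0 else 1) => u v auv.
have uv : u != v by apply: contraTneq auv => ->; rewrite adj_irr.
have Kuv : K u v != 0 by rewrite -graph_of_mxE.
apply: (@sign_inj R); rewrite signD.
have sgnD i : sgn (if D i i == 1 then 0 else 1) = D i i.
  by case: (D1 i) => ->; rewrite ?eqxx //; case: eqP.
rewrite !sgnD; apply: (mulIf Kuv); move/matrixP/(_ u v): defK'.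
have /diag_mxP[dv defD] := dgD; rewrite defD.
rewrite mul_mx_diag mxE mul_diag_mx !mxE (negbTE uv) !eqxx => ->.
by rewrite mulrAC.
Qed.

Lemma sign_diag_potential (L : 'M[R]_N) w : (forall i, L i i = K i i) ->
    (forall i j, i != j -> L i j = sgn (w [set i; j]) * K i j) ->
    has_potential G w ->
  exists D, sign_diag_mx D /\ L = D *m K *m D.
Proof.
move=> diagL Lw [d dP]; exists (diag_mx (\row_i sgn (d i))); split.
  split; first exact: diag_mx_is_diag.
  move=> i; rewrite !mxE eqxx.
  by case: (sign_cases R (d i)) => [[_ ->]|[_ ->]]; [left | right].
apply/matrixP=> i j; rewrite mul_mx_diag mxE mul_diag_mx !mxE.
have [-> | ij] := eqVneq i j; first by rewrite diagL mulrAC -expr2 sign_sqr mul1r.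
rewrite Lw //; have [->|Kij] := eqVneq (K i j) 0.
  by rewrite !(mulr0, mul0r).
rewrite dP; last by rewrite /adj graph_of_mxE.
by rewrite signD mulrAC.
Qed.

(** The weight of the matrix [L] is tested on an induced cycle by finding a
potential on its vertex set: the holes inside that set are short enough for
their minors to be given. This avoids listing an abstract induced cycle in cyclic
order. *)
Lemma determined_of_potential l : (2 < l)%N ->
  (forall w, vanishing G l w -> has_potential G w) -> determined_by_minors K l.
Proof.
move=> l2 pot L symL minL.
have diagE i : L i i = K i i.
  by rewrite -!principal_minor1 minL // cards1 (leq_trans _ l2).
have sqrE i j : L i j ^+ 2 = K i j ^+ 2.
  have [->|ij] := eqVneq i j; first by rewrite diagE.
  have /minL : (1 <= #|[set i; j]| <= l)%N by rewrite cards2 ij /= ltnW.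
  rewrite !principal_minor2 // !diagE => /addrI/oppr_inj.
  by rewrite (mx_symE _ _ symL) (mx_symE _ _ symK) -!expr2.
(* Both orders of the pair are tried, which is consistent by symmetry. *)
pose w (s : {set 'I_N}) : 'F_2 :=
  [exists p : 'I_N * 'I_N, (s == [set p.1; p.2]) && (L p.1 p.2 != K p.1 p.2)]%:R.
have wE i j : w [set i; j] = (L i j != K i j)%:R.
  congr (_%:R); congr nat_of_bool.
  apply/existsP/idP => [[[x y] /= /andP[/eqP E neq]]|neq]; last first.
    by exists (i, j); rewrite eqxx.
  have : x \in [set i; j] by rewrite E set21.
  have : y \in [set i; j] by rewrite E set22.
  have xy : x != y by apply: contraNneq neq => ->; rewrite diagE.
  rewrite !inE => /orP[]/eqP ey /orP[]/eqP ex; move: neq xy;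
    rewrite ex ey ?eqxx //.
  by rewrite (mx_symE _ _ symL) (mx_symE _ _ symK).
have LE i j : L i j = sgn (w [set i; j]) * K i j.
  rewrite wE; case: eqP => [->|/eqP neq] /=; first by rewrite mul1r.
  have /eqP := sqrE i j; rewrite eqf_sqr (negbTE neq) /= => /eqP->.
  by rewrite [sgn _](_ : _ = -1) ?mulN1r.
apply: (sign_diag_potential diagE (w := w)) => //.
apply: pot => H indH lenH.
have /andP[simpH _] := indH; have cycH := simple_is_cycle simpH.
pose S := [set v in H.1 | degree H.2 v != 0%N].
have le_S : (#|S| <= l)%N.
  by apply: leq_trans lenH; apply: simple_cycle_card simpH.
have [c hole_c cS|d dP] := @hole_potential_in _ G w S; last first.
  apply: (sum_potential_even cycH (d := d)) => u v uvH.
  apply: dP; first exact: cycle_edge_support cycH uvH.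
    by rewrite setUC in uvH; apply: cycle_edge_support cycH uvH.
  by case/and3P: cycH => /andP[/subsetP HG _] _ _; apply: HG.
have /and4P[c_gt2 Uc cyc _] := hole_c.
have /(hole_minor symK symL diagE sqrE hole_c) :
    \det (principal_submx L [set x in c]) =
    \det (principal_submx K [set x in c]).
  apply: minL; rewrite cardsE (card_uniqP Uc) (leq_trans _ c_gt2) //=.
  apply: leq_trans le_S; rewrite -(card_uniqP Uc).
  by apply/subset_leq_card/subsetP.
rewrite (eq_bigr _ (fun x _ => LE x (next c x))) big_split /= sign_sum.
rewrite -[RHS]mul1r => /mulIf E; apply: (@sign_inj R); rewrite E //.
rewrite prodf_seq_neq0; apply/allP=> x xc /=.
have axn : adj G x (next c x) by apply: next_cycle cyc xc.
have xn : x != next c x by rewrite eq_sym next_neq.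
by rewrite -(graph_of_mxE symK xn).
Qed.

End Main.

Theorem proposition1 (R : realType) (N : nat) (hN : (1 <= N)%N)
    (K : 'M[R]_N) (hK : K^T = K) (l : nat) (hl : (3 <= l)%N) :
  determined_by_minors K l <-> (cycle_sparsity (graph_of_mx K) <= l)%N.
Proof.
rewrite cycle_sparsity_leP; last exact: ltnW.
split; [exact: potential_of_determined | exact: determined_of_potential].
Qed.
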